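(* For any instance of the variable-group model (sets $N$ of $n$ agents and $M$ of $m$ goods, desired group sizes $n_1,\dots,n_k$ with $n_1+\dots+n_k=n$, and arbitrary normalized monotonic utility functions) such that the goods lie on a path $1,2,\dots,m$, there exists a connected EF1 outcome.
   Context: Variable-group model: let $k\ge 2$ and $n_1,\dots,n_k$ be positive integers, $N=[n]$ a set of $n=n_1+\dots+n_k$ agents, $M=[m]$ a set of $m$ goods. Each agent $a\in N$ has a utility function $u_a$ assigning a real number to each subset of $M$. Utilities are monotonic ($u_a(M')\le u_a(M'')$ whenever $M'\subseteq M''\subseteq M$) and normalized ($u_a(\emptyset)=0$). An allocation $A=(A_1,\dots,A_k)$ consists of $k$ disjoint (possibly empty) subsets of $M$; it is complete if $A_1\cup\dots\cup A_k=M$. An outcome $(C,A)$ consists of a partition $C=(C_1,\dots,C_k)$ of $N$ with $|C_i|=n_i$ for all $i\in[k]$, together with a complete allocation $A$. The goods lie on the path $1,2,\dots,m$ (in this order). An allocation $A$ is connected if each $A_j$ forms a (possibly empty) interval of consecutive goods on the path; an outcome $(C,A)$ is connected if $A$ is connected. An outcome $(C,A)$ is EF1 if for all $i,j\in[k]$ and every $a\in C_i$ there is $B\subseteq A_j$ with $|B|\le 1$ such that $u_a(A_i)\ge u_a(A_j\setminus B)$. *)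

(* Defs.v *)
(* MathComp; the real numbers are an arbitrary [R : realType]. *)
From HB Require Import structures.
From mathcomp Require Import all_boot all_order all_algebra reals.

Set Implicit Arguments.
Unset Strict Implicit.
Unset Printing Implicit Defensive.

Import Order.TTheory GRing.Theory Num.Theory.
Local Open Scope ring_scope.

(* The goods 1, ..., m are represented by 0, ..., m-1, i.e. by the type 'I_m,
   in path order; the agents are represented by 'I_n and the groups by 'I_k. *)

Definition normalized (R : realType) (m : nat) (u : {set 'I_m} -> R) : Prop :=
  u set0 = 0.

Definition monotonic (R : realType) (m : nat) (u : {set 'I_m} -> R) : Prop :=
  forall S T : {set 'I_m}, S \subset T -> u S <= u T.

Definition pairwise_disjoint (k : nat) (T : finType) (F : 'I_k -> {set T})
  : Prop :=
  forall i j : 'I_k, i != j -> [disjoint F i & F j].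

Definition covering (k : nat) (T : finType) (F : 'I_k -> {set T}) : Prop :=
  \bigcup_(i < k) F i = [set: T].

Definition allocation (k m : nat) (A : 'I_k -> {set 'I_m}) : Prop :=
  pairwise_disjoint A.

Definition complete (k m : nat) (A : 'I_k -> {set 'I_m}) : Prop :=
  covering A.

Definition group_partition (k n : nat) (sz : 'I_k -> nat)
    (C : 'I_k -> {set 'I_n}) : Prop :=
  [/\ pairwise_disjoint C, covering C & forall i : 'I_k, #|C i| = sz i].

Definition outcome (k n m : nat) (sz : 'I_k -> nat)
    (C : 'I_k -> {set 'I_n}) (A : 'I_k -> {set 'I_m}) : Prop :=
  [/\ group_partition sz C, allocation A & complete A].

(* Taking b <= a gives the empty interval. *)
Definition path_interval (m : nat) (S : {set 'I_m}) : Prop :=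
  exists a b : nat, S = [set x : 'I_m | (a <= x < b)%N].

Definition connected (k m : nat) (A : 'I_k -> {set 'I_m}) : Prop :=
  forall j : 'I_k, path_interval (A j).

Definition EF1 (R : realType) (k n m : nat) (u : 'I_n -> {set 'I_m} -> R)
    (C : 'I_k -> {set 'I_n}) (A : 'I_k -> {set 'I_m}) : Prop :=
  forall (i j : 'I_k) (a : 'I_n), a \in C i ->
    exists B : {set 'I_m},
      [/\ B \subset A j, (#|B| <= 1)%N & u a (A i) >= u a (A j :\: B)].

(* Main.v *)
Require Import Defs.
From mathcomp Require Import all_boot all_order all_algebra reals.
From mathcomp Require Import zify.

(* Put k - 1 knives on the path, at integer multiples of 1/D of a good. A piece
   with both end goods cut has no good discrete value: it may be rounded to its
   interior I, to pI, to Iq or to pIq. The remedy is to let its value depend on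
   the two fractional positions r (left) and r' (right): u(I) when r >= r', and
   min(u(pI), u(Iq)) when r < r'. If all knives are rounded with one common
   threshold T, then I can only arise when r >= r' and pIq only when r < r', so
   the value always lies between the utility of the rounded piece and that
   utility up to one good. Hence an agent who prefers piece j at some knife
   position is EF1-satisfied with piece j of the rounded allocation, and T can
   be chosen so that all positions in a given unit cube round alike.

   It remains to find a unit cube at whose points the agents have preferred
   pieces matching the prescribed group sizes. Interpolate, over a finer grid,
   the number of agents preferring each piece; give every point of the fine grid
   as label a piece demanded at least as much as its size requires. By Sperner's
   lemma all labels occur in a small cube, where therefore all the demands are
   almost the group sizes, and integrality in Hall's condition absorbs the
   error. *)

Set Implicit Arguments.
Unset Strict Implicit.
Unset Printing Implicit Defensive.
Import Order.TTheory GRing.Theory Num.Theory.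

(** * Hall's theorem with capacities *)

Definition fans (A K : finType) (likes : A -> K -> bool) (B : {set A}) (S : {set K}) : {set A} :=
  [set a in B | [exists j in S, likes a j]].

Lemma fansU (A K : finType) (likes : A -> K -> bool) B (S S' : {set K}) :
  fans likes B (S :|: S') = fans likes B S :|: fans likes B S'.
Proof.
apply/setP => a; rewrite !inE -andb_orr; congr (_ && _).
apply/existsP/orP => [[j]|[] /existsP[j /andP[jS aj]]].
- by rewrite inE andb_orl => /orP[] ?; [left|right]; apply/existsP; exists j.
- by exists j; rewrite inE jS.
- by exists j; rewrite inE jS orbT.
Qed.

Lemma fansS (A K : finType) (likes : A -> K -> bool) B (S S' : {set K}) :
  S \subset S' -> fans likes B S \subset fans likes B S'.
Proof. by move/setUidPr <-; rewrite fansU subsetUl. Qed.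

(** Induction on [#|B|]: one agent is matched, the capacity of its piece drops by one, and Hall's
    condition survives. *)
Lemma capacitated_hall (A K : finType) (likes : A -> K -> bool) (j0 : K)
    (B : {set A}) (c : K -> nat) :
  (forall S : {set K}, \sum_(j in S) c j <= #|fans likes B S|) ->
  \sum_j c j = #|B| ->
  exists g : A -> K, (forall a, a \in B -> likes a (g a)) /\
    forall j, #|[set a in B | g a == j]| = c j.
Proof.
elim: {B}_.+1 {-2}B c (ltnSn #|B|) => // N IH B c leN hall tot.
have [B0|[a aB]] := set_0Vmem B.
  exists (fun=> j0); split=> [a|j]; first by rewrite B0 inE.
  move: tot; rewrite B0 cards0 => /eqP; rewrite sum_nat_eq0 => /forallP/(_ j)/eqP ->.
  by apply/eqP; rewrite cards_eq0; apply/eqP/setP => a; rewrite !inE.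
pose tight (S : {set K}) := (\sum_(j in S) c j == #|fans likes B S|) && (a \in fans likes B S).
have tightT : tight [set: K].
  have sT : \sum_(j in [set: K]) c j = #|B|.
    by rewrite -tot; apply: eq_bigl => j; rewrite inE.
  have fT : fans likes B [set: K] = B.
    apply/eqP; rewrite eqEcard -sT hall andbT.
    by apply/subsetP => x; rewrite inE => /andP[].
  by rewrite /tight sT fT eqxx aB.
(* [a] receives an element of a minimal tight set [S]: another tight set
   obstructing this choice would meet [S] in a smaller tight set. *)
case: (arg_minnP (fun S : {set K} => #|S|) tightT) => S /andP[/eqP tS aS] minS.
(* Dropping the zero-capacity elements keeps the capacity sum of [S], so by Hall and tightness no
   fan is lost. *)
have [j [jS cj aj]] : exists j, [/\ j \in S, 0 < c j & likes a j].
  pose S0 := [set j in S | 0 < c j].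
  have s0 : \sum_(j in S0) c j = \sum_(j in S) c j.
    rewrite [RHS](bigID (fun j => 0 < c j)) /= [X in _ + X]big1 ?addn0.
      by apply: eq_bigl => j; rewrite inE.
    by move=> j; case: (c j) => [|?]; rewrite ?andbF.
  have sS : fans likes B S0 \subset fans likes B S.
    by apply/fansS/subsetP => x; rewrite inE => /andP[].
  have : a \in fans likes B S0.
    suff -> : fans likes B S0 = fans likes B S by [].
    by apply/eqP; rewrite eqEcard sS -tS -s0 hall.
  rewrite inE => /andP[_ /existsP[j]]; rewrite inE => /andP[/andP[? ?] ?].
  by exists j.
pose c' i := c i - (i == j).
have sc' (S' : {set K}) : \sum_(i in S') c' i + (j \in S') = \sum_(i in S') c i.
  case: (boolP (j \in S')) => jS'.
    rewrite (bigD1 j) //= [RHS](bigD1 j) //= /c' eqxx addnAC subnK //.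
    by congr (_ + _); apply: eq_bigr => i /andP[_ /negPf->]; rewrite subn0.
  rewrite addn0; apply: eq_bigr => i iS'; rewrite /c'.
  case: eqP => [ij|_]; last by rewrite subn0.
  by rewrite -ij iS' in jS'.
have fB S' : fans likes (B :\ a) S' = fans likes B S' :\ a.
  by apply/setP => x; rewrite !inE andbA.
have cB S' : (a \in fans likes B S') + #|fans likes (B :\ a) S'| = #|fans likes B S'|.
  by rewrite fB [RHS](cardsD1 a).
have cardB : (#|B :\ a|).+1 = #|B| by rewrite [RHS](cardsD1 a) aB.
have [|S'||g [gl gc]] := IH (B :\ a) c'.
- by rewrite -ltnS cardB.
- rewrite leqNgt; apply/negP => lt.
  have := hall S'; rewrite -sc' -cB.
  case: (boolP (j \in S')) => jS'.
    have -> : a \in fans likes B S'.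
      by rewrite inE aB; apply/existsP; exists j; rewrite jS'.
    by rewrite addn1 add1n ltnS leqNgt lt.
  rewrite addn0 => le.
  have aS' : a \in fans likes B S' by case: (_ \in _) le => //; rewrite leqNgt lt.
  have tS' : \sum_(i in S') c i = #|fans likes B S'|.
    by rewrite -sc' -cB aS' (negPf jS'); move: le lt; rewrite aS'; lia.
  (* By submodularity of the fan count, tightness of [S] and [S'] turns Hall's bounds for union and
     intersection into equalities. *)
  have sub : fans likes B (S :&: S') \subset fans likes B S :&: fans likes B S'.
    by rewrite subsetI !fansS // ?subsetIl ?subsetIr.
  have sUI : \sum_(i in S :|: S') c i + \sum_(i in S :&: S') c i =
             \sum_(i in S) c i + \sum_(i in S') c i.
    rewrite !(big_mkcond (fun i => i \in _)) -!big_split; apply: eq_bigr => i _ /=.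
    by rewrite !inE; case: (i \in S); case: (i \in S') => /=; lia.
  have cUI := cardsUI (fans likes B S) (fans likes B S').
  have hU := hall (S :|: S'); rewrite fansU in hU.
  have hI := hall (S :&: S').
  have eI : fans likes B (S :&: S') = fans likes B S :&: fans likes B S'.
    by apply/eqP; rewrite eqEcard sub; lia.
  have tI : tight (S :&: S').
    rewrite /tight eI inE aS aS' andbT; apply/eqP.
    by rewrite eI in hI; lia.
  have := minS _ tI; rewrite leqNgt => /negP; apply.
  apply: proper_card; apply/properP; split; first exact: subsetIl.
  by exists j => //; rewrite inE (negPf jS') andbF.
- have := sc' [set: K]; rewrite inE addn1.
  have eT f : \sum_(i in [set: K]) f i = \sum_i f i.
    by apply: eq_bigl => i; rewrite inE.
  by rewrite !eT; lia.
exists (fun x => if x == a then j else g x); split=> [x xB|i].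
  by case: eqP => [->//|/eqP xa]; apply: gl; rewrite !inE xa.
rewrite (cardsD1 a) inE aB eqxx /=.
have -> : [set x in B | (if x == a then j else g x) == i] :\ a = [set x in B :\ a | g x == i].
  by apply/setP => x; rewrite !inE; case: eqP; rewrite ?andbF.
by rewrite gc /c'; case: (eqVneq i j) => [->|_]; lia.
Qed.

(** * Sperner's lemma for cubical grids *)

(** The terms below and above the diagonal agree by symmetry and cancel mod 2. This will make the
    coboundary square to zero. *)
Lemma big_addb_offdiag (n : nat) (P : pred 'I_n) (g : 'I_n -> 'I_n -> bool) :
  (forall i j, g i j = g j i) ->
  \big[addb/false]_(i | P i) \big[addb/false]_(j | P j && (j != i)) g i j = false.
Proof.
move=> gC.
have split i : \big[addb/false]_(j | P j && (j != i)) g i j =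
    \big[addb/false]_(j | P j && (j < i)) g i j (+) \big[addb/false]_(j | P j && (i < j)) g i j.
  rewrite (bigID (fun j : 'I_n => j < i)) /=; congr (_ (+) _); apply: eq_bigl => j.
    by rewrite -andbA neq_ltn andb_orl andbb [(i < j) && _]andbC; case: ltngtP; rewrite ?orbF.
  by rewrite -andbA -leqNgt ltn_neqAle [j == i :> 'I_n]eq_sym.
under eq_bigr do rewrite split.
rewrite big_split /= [X in _ (+) X](exchange_big_dep P) /=; last by move=> i j _ /andP[].
rewrite [X in _ (+) X](_ : _ = \big[addb/false]_(i | P i) \big[addb/false]_(j | P j && (j < i)) g i j).
  exact: addbb.
by apply: eq_bigr => i Pi; apply: eq_big => [j|j _]; rewrite ?Pi // gC.
Qed.

Definition upd (d : nat) (T : Type) (c : {ffun 'I_d -> T}) (i : 'I_d) (x : T) :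
    {ffun 'I_d -> T} :=
  [ffun j => if j == i then x else c j].

Lemma upd_id d T (c : {ffun 'I_d -> T}) i : upd c i (c i) = c.
Proof. by apply/ffunP => j; rewrite !ffunE; case: eqP => [->|]. Qed.

Lemma upd_upd d T (c : {ffun 'I_d -> T}) i x y : upd (upd c i x) i y = upd c i y.
Proof. by apply/ffunP => j; rewrite !ffunE; case: eqP. Qed.

Lemma updC d T (c : {ffun 'I_d -> T}) i j x y :
  i != j -> upd (upd c i x) j y = upd (upd c j y) i x.
Proof.
by move=> ij; apply/ffunP => l; rewrite !ffunE; case: eqP => // ->; rewrite eq_sym (negPf ij).
Qed.

(** Each grid line in direction [i] telescopes to its two ends; its point with [g i = 0] represents
    the line. *)
Lemma big_addb_telescope (d G : nat) (P : pred {ffun 'I_d -> 'I_G.+1}) (i : 'I_d)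
    (K : {ffun 'I_d -> 'I_G.+1} -> nat -> bool) :
  (forall g x, P (upd g i x) = P g) -> (forall g x t, K (upd g i x) t = K g t) ->
  \big[addb/false]_(g | P g) (K g (g i) (+) K g (g i).+1) =
  \big[addb/false]_(g | P g && (g i == ord0)) (K g 0 (+) K g G.+1).
Proof.
move=> PE KE.
rewrite (partition_big (fun g => upd g i ord0) (fun g => P g && (g i == ord0))) /=; last first.
  by move=> g Pg; rewrite PE Pg ffunE eqxx.
apply: eq_bigr => g /andP[Pg /eqP g0].
rewrite (reindex_onto (fun t => upd g i t) (fun g' => g' i)) /=; last first.
  by move=> g' /andP[_ /eqP <-]; rewrite upd_upd upd_id.
under eq_bigl => t do rewrite PE Pg upd_upd ffunE !eqxx -g0 upd_id eqxx.
under eq_bigr => t _ do rewrite ffunE eqxx !KE.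
elim: (G.+1) => [|n IH]; first by rewrite big_ord0 addbb.
by rewrite big_ord_recr /= IH addbA -(addbA (K g 0)) addbb addbF.
Qed.

(* A face of the cubical grid is encoded by its doubled midpoint: an even
   coordinate [2 v] is the point [v], an odd one [2 v + 1] the edge [v, v + 1]. *)
Definition corner (d : nat) (c : {ffun 'I_d -> nat}) (b : {ffun 'I_d -> bool}) :
    {ffun 'I_d -> nat} :=
  [ffun i => (c i + b i)./2].

Definition facet (d : nat) (c : {ffun 'I_d -> nat}) (i : 'I_d) (s : bool) :=
  upd c i ((c i).-1 + s.*2).

Section CubicalSperner.
Variables (d : nat) (lab : {ffun 'I_d -> nat} -> nat).
Implicit Types (c : {ffun 'I_d -> nat}) (i j : 'I_d) (s t : bool).

Definition low e c := [forall b, lab (corner c b) <= e].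

(* Parity standing for the number of fully labelled simplices in an [e]-face.
   Summing over facets is a coboundary mod 2, so the sum for [e.+1] vanishes
   unless the label [e.+1] occurs. *)
Fixpoint full e c : bool :=
  if e is e'.+1 then
    low e c && \big[addb/false]_(i | odd (c i)) \big[addb/false]_s full e' (facet c i s)
  else lab (corner c [ffun=> false]) == 0.

Lemma corner_facet c i s b :
  odd (c i) -> exists b', corner (facet c i s) b = corner c b'.
Proof.
move=> ci; exists (upd b i s); apply/ffunP => j; rewrite !ffunE.
by case: eqP => [->|//]; lia.
Qed.

Lemma low_facet e c i s : odd (c i) -> low e c -> low e (facet c i s).
Proof.
move=> ci /forallP lowc; apply/forallP => b.
by have [b' ->] := corner_facet s b ci.
Qed.

Lemma odd_facet c i s j : odd (c i) -> odd (facet c i s j) = odd (c j) && (j != i).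
Proof. by move=> ci; rewrite ffunE; case: eqP => [->|]; lia. Qed.

Lemma facetC c i j s t : i != j -> facet (facet c i s) j t = facet (facet c j t) i s.
Proof. by move=> ij; rewrite /facet updC // !ffunE (eq_sym j) (negPf ij). Qed.

(** For [e > 0], each face of codimension two is reached by two orders of the directions, and these
    cancel. For [e = 0] all corners have label 0, so opposite facets cancel. *)
Lemma full_boundary e c : low e c ->
  \big[addb/false]_(i | odd (c i)) \big[addb/false]_s full e (facet c i s) = false.
Proof.
case: e => [|e] lowc /=.
  rewrite big1 // => i ci; rewrite big_bool /=.
  have z s : lab (corner (facet c i s) [ffun=> false]) == 0.
    have [b' ->] := corner_facet s [ffun=> false] ci.
    by have /forallP/(_ b') := lowc; rewrite leqn0.
  by rewrite !z.
pose h i j := \big[addb/false]_s \big[addb/false]_t full e (facet (facet c i s) j t).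
pose g i j := (i != j) && h i j.
rewrite -[RHS](@big_addb_offdiag d (fun i => odd (c i)) g); last first.
  move=> i j; rewrite /g eq_sym; case: eqVneq => //= ji.
  rewrite /h exchange_big; apply: eq_bigr => s _; apply: eq_bigr => t _.
  by rewrite facetC // eq_sym.
apply: eq_bigr => i ci.
under eq_bigr => s _ do rewrite low_facet //=.
under eq_bigr => s _ do under eq_bigl => j do rewrite odd_facet //.
rewrite exchange_big /=; apply: eq_bigr => j /andP[_ ji].
by rewrite /g eq_sym ji.
Qed.

(** A nonzero sum yields a full facet, which supplies the labels up to [e]; without label [e.+1],
    [full_boundary] would make the sum vanish. *)
Lemma full_labels e c : full e c ->
  forall l, l <= e -> exists b, lab (corner c b) = l.
Proof.
elim: e c => [|e IH] c /=.
  by move/eqP=> l0 l; rewrite leqn0 => /eqP ->; exists [ffun=> false].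
case/andP=> lowc fullc l.
rewrite leq_eqVlt => /orP[/eqP ->|].
  case: (boolP [exists b, lab (corner c b) == e.+1]) => [/existsP[b /eqP]|].
    by exists b.
  rewrite negb_exists => /forallP ne; suff lowe : low e c by rewrite full_boundary in fullc.
  apply/forallP => b; rewrite -ltnS ltn_neqAle ne.
  by have /forallP/(_ b) := lowc.
rewrite ltnS => le.
have [i ci [s fi]] : exists2 i, odd (c i) & exists s, full e (facet c i s).
  apply/'exists_in_existsP.
  apply: contraTT fullc => /exists_inPn ne; rewrite big1 // => i /ne.
  rewrite negb_exists => /forallP nes; rewrite big1 // => s _; exact: negbTE (nes s).
have [b <-] := IH _ fi _ le.
by have [b' ->] := corner_facet s b ci; exists b'.
Qed.

Section Grid.
Variable G : nat.
Hypothesis lab0 : forall (v : {ffun 'I_d -> nat}) i, v i = 0 -> i < lab v.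
Hypothesis labG : forall (v : {ffun 'I_d -> nat}) i, v i = G.+1 -> lab v != i.+1.
Hypothesis lab_le : forall v, lab v <= d.

Definition cell e (g : {ffun 'I_d -> 'I_G.+1}) : {ffun 'I_d -> nat} :=
  [ffun i : 'I_d => if i < e then (g i).*2.+1 else G.+1.*2].

Definition slice e : pred {ffun 'I_d -> 'I_G.+1} :=
  fun g => [forall i : 'I_d, (e <= i) ==> (g i == ord0)].

Lemma lab_on_slice e (v : {ffun 'I_d -> nat}) : e <= d -> (forall i : 'I_d, e <= i -> v i = G.+1) -> lab v <= e.
Proof.
move=> ed vG; rewrite leqNgt; apply/negP; have := lab_le v.
case E: (lab v) => [//|l] ld el.
have /eqP := labG (vG (Ordinal ld) el); exact.
Qed.

Lemma low_cell e g : e <= d -> low e (cell e g).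
Proof.
move=> ed; apply/forallP => b; apply: lab_on_slice => // i ei.
by rewrite !ffunE ltnNge ei /=; lia.
Qed.

Lemma full_face0 e c i : c i = 0 -> full e c = false.
Proof.
move=> ci; apply/negP => /full_labels/(_ 0 (leq0n _)) [b lb].
have : corner c b i = 0 by rewrite ffunE ci; case: (b i).
by move/lab0; rewrite lb.
Qed.

Lemma full_faceG e c i : i < e -> c i = G.+1.*2 -> full e c = false.
Proof.
move=> ie ci; apply/negP => /full_labels/(_ i.+1 ie) [b lb].
have : corner c b i = G.+1 by rewrite ffunE ci; case: (b i); lia.
by move/labG; rewrite lb eqxx.
Qed.

(** Induction on [e]: facets inside the face cancel by telescoping. On its boundary, coordinate 0
    excludes label 0, and coordinate [G.+1] in a direction [i < e] excludes label [i.+1]. Direction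
    [e] leaves the sum for [e]. *)
Lemma full_slice_odd e : e <= d -> \big[addb/false]_(g | slice e g) full e (cell e g).
Proof.
elim: e => [|e IH] ed.
  rewrite (big_pred1 [ffun=> ord0]) => [|g] /=.
    by rewrite -leqn0 lab_on_slice // => i _; rewrite !ffunE /=; lia.
  apply/forallP/eqP => [z|-> i]; last by rewrite ffunE.
  by apply/ffunP => i; rewrite ffunE; apply/eqP/z.
pose ie := Ordinal ed.
pose K i g (p : nat) := full e (upd (cell e.+1 g) i p.*2).
have -> : \big[addb/false]_(g | slice e.+1 g) full e.+1 (cell e.+1 g) =
    \big[addb/false]_(i < d | i < e.+1) \big[addb/false]_(g | slice e.+1 g) (K i g (g i) (+) K i g (g i).+1).
  rewrite exchange_big /=; apply: eq_bigr => g _.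
  rewrite low_cell //=; apply: eq_big => [i|i].
    by rewrite ffunE; case: ifP; lia.
  rewrite ffunE; case: ifP => [ie1 _|]; last by lia.
  rewrite big_bool /= addbC /K /facet ffunE ie1 /=.
  by congr (full _ (upd _ _ _) (+) full _ (upd _ _ _)); lia.
have tele i : i < e.+1 ->
    \big[addb/false]_(g | slice e.+1 g) (K i g (g i) (+) K i g (g i).+1) =
    \big[addb/false]_(g | slice e.+1 g && (g i == ord0)) K i g G.+1.
  move=> ie1; rewrite big_addb_telescope => [|g x|g x t].
  - by apply: eq_bigr => g _; rewrite {1}/K (@full_face0 _ _ i) // ffunE eqxx.
  - apply: eq_forallb => j; rewrite ffunE; case: (eqVneq j i) => // ->.
    by rewrite leqNgt ie1.
  - by congr full; apply/ffunP => j; rewrite !ffunE; case: eqP.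
rewrite (bigD1 ie) //= [X in _ (+) X]big1 ?addbF => [|i /andP[ie1 ine]].
  rewrite tele //=; apply: etrans (IH (ltnW ed)); apply: eq_big => [g|g].
    apply/andP/forallP => [[/forallP sg g0] i|sg].
      by apply/implyP; rewrite leq_eqVlt => /orP[/eqP ei|/(implyP (sg i))//];
         rewrite (_ : i = ie) //; apply: val_inj.
    split; last exact: (implyP (sg ie)).
    by apply/forallP => i; apply/implyP => /ltnW; apply/implyP.
  move=> _; congr full; apply/ffunP => i; rewrite !ffunE; case: eqP => [->|/eqP ne].
    by rewrite /= ltnn.
  by rewrite ltnS leq_eqVlt (_ : (i == e :> nat) = false) //; apply: negbTE.
rewrite tele // big1 // => g _; apply: (@full_faceG _ _ i); last by rewrite ffunE eqxx.
by rewrite ltn_neqAle -ltnS ie1 andbT.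
Qed.

Lemma cubical_sperner :
  exists g : {ffun 'I_d -> nat}, forall l, l <= d ->
    exists b : {ffun 'I_d -> bool}, lab [ffun i => g i + b i] = l.
Proof.
have [g fg] : exists g, full d (cell d g).
  apply/existsP; apply: contraTT (full_slice_odd (leqnn d)).
  rewrite negb_exists => /forallP nf; rewrite big1 // => g _.
  exact: negbTE (nf g).
exists [ffun i => val (g i)] => l /(full_labels fg)[b <-]; exists b.
congr lab; apply/ffunP => i; rewrite !ffunE ltn_ord.
by case: (b i) => /=; lia.
Qed.

End Grid.
End CubicalSperner.

(** * Knives and pieces *)

Definition round_knife (D T c : nat) : nat := c %/ D + (T <= c %% D).

(** When the residue wraps from [D - 1] to 0, the quotient gains what the threshold bit loses; only
    the step from [T - 1] to [T] moves the rounded knife. *)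
Lemma round_knife_succ D T c : 0 < T < D -> c %% D != T.-1 ->
  round_knife D T c.+1 = round_knife D T c.
Proof.
move=> /andP[T0 TD] cT; have D0 : 0 < D by apply: leq_ltn_trans TD.
have rD := ltn_pmod c D0; have cE := divn_eq c D.
have [rlt|rge] := ltnP (c %% D).+1 D.
  have -> : c.+1 = c %/ D * D + (c %% D).+1 by lia.
  by rewrite /round_knife divnMDl // modnMDl (divn_small rlt) (modn_small rlt) addn0; lia.
have -> : c.+1 = (c %/ D).+1 * D + 0 by lia.
by rewrite /round_knife divnMDl // modnMDl div0n mod0n addn0; lia.
Qed.

Lemma leq_round_knife D T c c' : 0 < D -> c <= c' -> round_knife D T c <= round_knife D T c'.
Proof.
move=> D0 cc'; rewrite /round_knife.
have := leq_div2r D cc'; rewrite leq_eqVlt => /orP[/eqP e|]; last by lia.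
by have := divn_eq c D; have := divn_eq c' D; rewrite -e; lia.
Qed.

Section Pieces.
Variables (R : realDomainType) (U : nat -> nat -> R).
Hypothesis U_nil : forall a b, b <= a -> U a b = 0%R.
Hypothesis U_mono : forall a a' b b', a' <= a -> b <= b' -> (U a b <= U a' b')%R.

(* With [c = D t + r] and [c' = D t' + r'], the goods [t] and [t'] are cut if
   [r > 0] and [r' > 0]. *)
Definition piece_value (D c c' : nat) : R :=
  if 0 < c %% D < c' %% D
  then Num.min (U (c %/ D) (c' %/ D)) (U (c %/ D).+1 (c' %/ D).+1)
  else U (c %/ D + (0 < c %% D)) (c' %/ D).

Lemma piece_value_nil D c : piece_value D c c = 0%R.
Proof. by rewrite /piece_value ltnn andbF U_nil // leq_addr. Qed.

Lemma piece_value_ge0 D c c' : (0 <= piece_value D c c')%R.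
Proof.
have U0 a b : (0 <= U a b)%R.
  by rewrite -(U_nil (leqnn b)); case: (leqP a b) => [/U_mono->//|ba]; rewrite !U_nil // ltnW.
by rewrite /piece_value; case: ifP => // _; rewrite le_min !U0.
Qed.

Lemma piece_value_round D T c c' : 0 < T < D ->
  let a := round_knife D T c in let b := round_knife D T c' in
  (piece_value D c c' <= U a b)%R /\
  ((U a.+1 b <= piece_value D c c')%R \/ (U a b.-1 <= piece_value D c c')%R).
Proof.
rewrite /round_knife /piece_value => /andP[T0 TD] /=.
move: (c %/ D) (c %% D) (c' %/ D) (c' %% D) => t r t' r'.
case: ifP => [/andP[r0 rr']|rr'].
- split.
    rewrite ge_min; case: (leqP T r) => Tr; apply/orP; [right|left]; apply: U_mono; lia.
  case: (leqP T r) => Tr; case: (leqP T r') => Tr'; try lia.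
  + by right; rewrite le_min !U_mono; lia.
  (* The rounded piece is [pIq]: either term of the minimum is its utility without one end good. *)
  + case: (leP (U t t') (U t.+1 t'.+1)) => _; [right|left]; apply: U_mono; lia.
  + by left; rewrite le_min !U_mono; lia.
- split; first by apply: U_mono; lia.
  case: (posnP r) => r0; first by right; apply: U_mono; lia.
  case: (leqP T r) => Tr; case: (leqP T r') => Tr'; try lia.
  + by right; apply: U_mono; lia.
  + by left; apply: U_mono; lia.
  + by left; apply: U_mono; lia.
Qed.

Section Favourite.
Variables (d D : nat).
Implicit Type y : seq nat.

Definition nth_value y (j : nat) : R := piece_value D (nth 0 y j) (nth 0 y j.+1).

(** Only pieces of positive length compete; this secures the boundary conditions of Sperner's
    lemma. *)
Definition favourite y : 'I_d.+1 :=
  odflt ord0 [pick i : 'I_d.+1 | (nth 0 y i < nth 0 y i.+1) &&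
    [forall l : 'I_d.+1, (nth_value y l <= nth_value y i)%R]].

(** Zero-length pieces have value 0 and no value is negative, so the best piece of positive length
    is best overall. *)
Lemma favouriteP y :
  (forall j, j <= d -> nth 0 y j <= nth 0 y j.+1) -> nth 0 y 0 < nth 0 y d.+1 ->
  nth 0 y (favourite y) < nth 0 y (favourite y).+1 /\
  forall l : 'I_d.+1, (nth_value y l <= nth_value y (favourite y))%R.
Proof.
move=> ymono y0; rewrite /favourite; case: pickP => [i /andP[? /forallP]//|none].
pose P (i : 'I_d.+1) := nth 0 y i < nth 0 y i.+1.
have [i0 Pi0] : exists i0, P i0.
  apply/existsP; apply: contraLR y0; rewrite negb_exists => /forallP nP.
  rewrite -leqNgt; suff: forall j, j <= d.+1 -> nth 0 y j <= nth 0 y 0 by apply.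
  elim=> // j IH jd.
  by apply: leq_trans (IH (ltnW jd)); have := nP (Ordinal jd); rewrite -leqNgt.
case: (arg_maxP (fun i : 'I_d.+1 => nth_value y i) Pi0) => i Pi imax.
have := none i; rewrite -[(_ < _)]/(P i) Pi /= => /negbT/forallPn[l /negP[]].
have := ymono l (ltn_ord l); rewrite leq_eqVlt => /orP[/eqP e|/imax//].
by rewrite {1}/nth_value -e piece_value_nil piece_value_ge0.
Qed.
End Favourite.
End Pieces.

Section Knives.
Variables (d G : nat).
Implicit Type y : {ffun 'I_d -> nat}.

(* Suffix minima turn an arbitrary point of the cube into ordered knives. *)
Definition knife y (j : nat) : nat :=
  if j is j'.+1 then \big[Order.min/G]_(i < d | j' <= i) y i else 0.

Lemma knife_last y : knife y d.+1 = G.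
Proof. by rewrite /knife big_pred0 // => i; rewrite leqNgt ltn_ord. Qed.

Lemma knife_recl y (i : 'I_d) : knife y i.+1 = minn (y i) (knife y i.+2).
Proof.
rewrite /knife (bigminD1 i) //= minEnat; congr minn; apply: eq_bigl => j.
by rewrite ltn_neqAle eq_sym andbC.
Qed.

Lemma knife_mono y j : j <= d -> knife y j <= knife y j.+1.
Proof.
case: j => // j jd; rewrite (knife_recl y (Ordinal jd)); exact: geq_minr.
Qed.

Lemma knife_shift y (b : {ffun 'I_d -> bool}) j :
  knife y j <= knife [ffun i => y i + b i] j <= (knife y j).+1.
Proof.
case: j => [|j] //=.
apply: (big_ind2 (fun p q => p <= q <= p.+1)) => [|p q p' q'|i _]; rewrite ?minEnat; try lia.
by rewrite ffunE; case: (b i); lia.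
Qed.

Lemma knife_le y i j : i <= j <= d.+1 -> knife y i <= knife y j.
Proof.
case/andP; elim: j => [|j IH]; first by rewrite leqn0 => /eqP->.
rewrite leq_eqVlt => /orP[/eqP->//|ij] jd.
exact: leq_trans (IH ij (ltnW jd)) (knife_mono _ _).
Qed.

(* As [s] runs over [0, L), these are the vertices of the simplex of the coarse
   Freudenthal triangulation around [knife y / L], each as often as L times its
   barycentric coordinate. *)
Definition coarse (L s : nat) y : seq nat := mkseq (fun j => (knife y j + s) %/ L) d.+2.

Lemma nth_coarse L s y j : j <= d.+1 -> nth 0 (coarse L s y) j = (knife y j + s) %/ L.
Proof. by move=> jd; rewrite nth_mkseq. Qed.

(** One fine step of a knife changes its coarse position for at most one [s < L], and there are
    [d.+2] knives, ends included. *)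
Lemma coarse_shift L y (b : {ffun 'I_d -> bool}) : 0 < L ->
  \sum_(s < L) (coarse L s [ffun i => y i + b i] != coarse L s y) <= d.+2.
Proof.
move=> L0.
have one k k' : k <= k' <= k.+1 -> \sum_(s < L) ((k' + s) %/ L != (k + s) %/ L) <= 1.
  move=> /andP[kk' k'k].
  rewrite -big_mkcond sum1_card; apply/card_le1_eqP => s s'.
  rewrite !unfold_in => ns ns'; apply: val_inj.
  have {kk'} k'E : k' = k.+1.
    by apply/eqP; rewrite eqn_leq k'k ltn_neqAle kk' andbT; apply: contra ns => /eqP->.
  have dvd p : (k' + p) %/ L != (k + p) %/ L -> L %| k + p.+1.
    by rewrite k'E addnS addSn divnS // -[X in _ != X]add0n eqn_add2r; case: (L %| _).
  have small p : p < L -> L %| p -> p = 0.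
    by case: p => // p pL /(dvdn_leq (ltn0Sn p)); rewrite leqNgt pL.
  have := ltn_ord s; have := ltn_ord s'.
  have := dvdn_sub (dvd s ns) (dvd s' ns'); have := dvdn_sub (dvd s' ns') (dvd s ns).
  rewrite !subnDl !subSS => /small + /small + s'L sL.
  move=> /(_ (leq_ltn_trans (leq_subr _ _) s'L))/eqP + /(_ (leq_ltn_trans (leq_subr _ _) sL))/eqP.
  by rewrite !subn_eq0 => le1 le2; apply/eqP; rewrite eqn_leq le1 le2.
rewrite -[X in _ <= X]muln1 -[X in X * 1]card_ord -sum_nat_const.
apply: leq_trans (_ : \sum_(j < d.+2) \sum_(s < L)
   ((knife [ffun i => y i + b i] j + s) %/ L != (knife y j + s) %/ L) <= _); last first.
  by apply: leq_sum => j _; apply: one; apply: knife_shift.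
rewrite exchange_big; apply: leq_sum => s _.
case: eqP => //= ne; rewrite lt0n.
apply: contra_notN ne; rewrite sum_nat_eq0 => /forallP same.
apply/eq_in_map => j; rewrite mem_iota /= add0n => jd.
by have := same (Ordinal jd); rewrite /= eqb0 negbK => /eqP.
Qed.
End Knives.

(** * Balancing the demands *)

Section Averaging.
Variables (n d G L : nat) (sz : 'I_d.+1 -> nat) (fav : 'I_n -> seq nat -> 'I_d.+1).
Hypothesis sz_gt0 : forall j, 0 < sz j.
Hypothesis sz_sum : n = \sum_j sz j.
Hypothesis L_big : d.+1 * (n * d.+2) < L.
Implicit Type y : {ffun 'I_d -> nat}.
Hypothesis favP : forall a s y, s < L ->
  let c := coarse G.+1 L s y in nth 0 c (fav a c) < nth 0 c (fav a c).+1.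

Definition demand y (j : 'I_d.+1) : nat :=
  \sum_(a < n) \sum_(s < L) (fav a (coarse G.+1 L s y) == j).

Lemma sum_demand y : \sum_j demand y j = n * L.
Proof.
rewrite exchange_big /= -[n in RHS]card_ord -sum_nat_const; apply: eq_bigr => a _.
rewrite exchange_big /= -[L in RHS]muln1 -[L in RHS]card_ord -sum_nat_const.
apply: eq_bigr => s _; rewrite (bigD1 (fav a (coarse G.+1 L s y))) //= eqxx big1 // => j.
by rewrite eq_sym => /negPf->.
Qed.

Lemma demand_shift y (b : {ffun 'I_d -> bool}) j :
  demand [ffun i => y i + b i] j <= demand y j + n * d.+2.
Proof.
rewrite -[n in n * _]card_ord -sum_nat_const -big_split /=; apply: leq_sum => a _.
have L0 : 0 < L by apply: leq_ltn_trans L_big.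
apply: leq_trans (leq_add (leqnn _) (coarse_shift G.+1 y b L0)); rewrite -big_split.
by apply: leq_sum => s _; case: (eqVneq (coarse _ _ _ _) _) => [->|_] /=; [rewrite addn0|rewrite addn1; case: eqP].
Qed.

Lemma demand_knife y j : 0 < demand y j -> knife G.+1 y j < knife G.+1 y j.+1.
Proof.
rewrite lt0n; apply: contraNltn => le.
rewrite /demand sum_nat_eq0; apply/forallP => a; rewrite sum_nat_eq0; apply/forallP => s /=.
rewrite eqb0; apply/eqP => fj; have := favP a y (ltn_ord s); cbv zeta; rewrite fj.
rewrite !nth_coarse ?(ltnW (ltn_ord j)) ?ltn_ord // ltnNge => /negP; apply.
by apply: leq_div2r; rewrite leq_add2r.
Qed.

Definition overdemanded y : 'I_d.+1 := odflt ord0 [pick j | sz j * L <= demand y j].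

(** Pigeonhole: over all pieces, both sides sum to [n * L]. *)
Lemma overdemandedP y : sz (overdemanded y) * L <= demand y (overdemanded y).
Proof.
rewrite /overdemanded; case: pickP => //= none.
have : \sum_j (demand y j + 1) <= \sum_j sz j * L.
  by apply: leq_sum => j _; rewrite addn1 ltnNge none.
by rewrite big_split -big_distrl -sz_sum /= sum_demand sum1_card card_ord; lia.
Qed.

Lemma balanced_demand : exists y, forall j, sz j * L <= demand y j + n * d.+2.
Proof.
have L0 : 0 < L by apply: leq_ltn_trans L_big.
have od y : knife G.+1 y (overdemanded y) < knife G.+1 y (overdemanded y).+1.
  by apply: demand_knife; apply: leq_trans (overdemandedP y); rewrite muln_gt0 sz_gt0.
have [||y|y yP] := @cubical_sperner d (fun y => overdemanded y : nat) G.
(* The knives up to [i.+1] all stand at 0, so no piece up to [i] has positive length. *)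
- move=> y i yi; have := od y; rewrite ltnNge; apply: contraNltn => le.
  have : knife G.+1 y (overdemanded y).+1 <= knife G.+1 y i.+1 by apply: knife_le; rewrite ltnS le /= ltnS ltnW.
  by rewrite knife_recl yi min0n leqn0 => /eqP->.
(* Both knives of piece [i.+1] stand at the right end [G.+1]. *)
- move=> y i yi; have := od y; apply: contraL => /eqP ->.
  rewrite -leqNgt [knife _ _ i.+1]knife_recl yi leq_min leqnn andbT.
  by rewrite -[X in _ <= X](knife_last G.+1 y) knife_le // leqnn andbT !ltnS.
- by rewrite -ltnS.
exists y => j; have [b] := yP j (ltn_ord j).
by move/val_inj => <-; apply: leq_trans (overdemandedP _) (demand_shift _ _ _).
Qed.

Lemma balanced_assignment : exists y (g : 'I_n -> 'I_d.+1),
  (forall a, exists s : 'I_L, fav a (coarse G.+1 L s y) = g a) /\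
  (forall j, #|[set a | g a == j]| = sz j).
Proof.
have L0 : 0 < L by apply: leq_ltn_trans L_big.
have [y yP] := balanced_demand; exists y.
pose likes a j := [exists s : 'I_L, fav a (coarse G.+1 L s y) == j].
have [S||g [gl gc]] := @capacitated_hall _ _ likes ord0 [set: 'I_n] sz.
(* Each fan contributes at most [L] to the demands in [S], other agents nothing. So Hall's
   inequality times [L] holds up to an error below [L], hence exactly. *)
- rewrite -ltnS -(ltn_pmul2r L0) mulSn addnC.
  apply: leq_trans (_ : #|fans likes setT S| * L + d.+1 * (n * d.+2) < _); last by rewrite ltn_add2l.
  rewrite ltnS big_distrl /=.
  apply: leq_trans (_ : \sum_(j in S) (demand y j + n * d.+2) <= _).
    by apply: leq_sum => j _.
  rewrite big_split /=.
  apply: leq_add; last first.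
    rewrite sum_nat_const leq_mul2r; apply/orP; right.
    by rewrite -[d.+1 in X in _ <= X]card_ord max_card.
  rewrite exchange_big /= -sum_nat_const [X in _ <= X]big_mkcond /=.
  apply: leq_sum => a _; rewrite exchange_big /=.
  case: (boolP (a \in fans likes setT S)) => [_|aS].
    rewrite -[X in _ <= X]muln1 -[X in X * 1]card_ord -sum_nat_const; apply: leq_sum => s _.
    rewrite big_mkcond (bigD1 (fav a (coarse G.+1 L s y))) //= eqxx.
    rewrite big1 => [|j]; first by rewrite addn0; case: ifP.
    by rewrite eq_sym => /negPf->; rewrite if_same.
  rewrite big1 // => s _; rewrite big1 // => j jS; apply/eqP; rewrite eqb0.
  apply: contra aS => e; rewrite !inE /=; apply/existsP; exists j; rewrite jS.
  by apply/existsP; exists s.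
- by rewrite cardsT card_ord.
exists g; split=> [a|j]; last by rewrite -gc; apply: eq_card => a; rewrite !inE.
by have /existsP[s /eqP] := gl a (in_setT _); exists s.
Qed.
End Averaging.

(** * Rounding the knives *)

Lemma avoid_residues (D : nat) (r : seq nat) : (size r).+1 < D ->
  exists2 T, 0 < T < D & T.-1 \notin r.
Proof.
case: D => // D rD; have /allPn[t] : ~~ all (mem r) (iota 0 D).
  apply/negP => /allP sub; have := uniq_leq_size (iota_uniq _ _) sub.
  by rewrite size_iota leqNgt -ltnS rD.
by rewrite mem_iota => ? tr; exists t.+1; first lia.
Qed.

Lemma divnD_small L k s : s < L -> (k + s) %/ L = k %/ L \/ (k + s) %/ L = (k %/ L).+1.
Proof.
move=> sL; have L0 : 0 < L by apply: leq_ltn_trans sL.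
have := divnD k s L0; rewrite (divn_small sL) addn0 => ->.
by case: (L <= _); [right|left]; rewrite ?addn1 ?addn0.
Qed.

Definition segment (m a b : nat) : {set 'I_m} := [set x : 'I_m | a <= x < b].

Section Cuts.
Variables (m d : nat) (cut : nat -> nat).
Hypothesis cut_mono : forall i j, i <= j <= d.+1 -> cut i <= cut j.

Lemma segments_disjoint :
  pairwise_disjoint (fun j : 'I_d.+1 => segment m (cut j) (cut j.+1)).
Proof.
have lt (i j : 'I_d.+1) : i < j -> [disjoint segment m (cut i) (cut i.+1) & segment m (cut j) (cut j.+1)].
  move=> ij; rewrite disjoint_subset; apply/subsetP => x; rewrite !inE => /andP[_ xi].
  have : cut i.+1 <= cut j by apply: cut_mono; rewrite ij ltnW.
  by lia.
by move=> i j; rewrite neq_ltn => /orP[/lt//|/lt]; rewrite disjoint_sym.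
Qed.

Hypothesis cut0 : cut 0 = 0.
Hypothesis cut_last : m <= cut d.+1.

Lemma segments_cover : covering (fun j : 'I_d.+1 => segment m (cut j) (cut j.+1)).
Proof.
apply/setP => x; rewrite inE; apply/bigcupP.
have ex : exists j, x < cut j by exists d.+1; apply: leq_trans cut_last.
case: (ex_minnP ex) => [[|j]] xj jmin; first by rewrite cut0 in xj.
have jd : j < d.+1 by apply: jmin; apply: leq_trans cut_last.
exists (Ordinal jd) => //; rewrite inE /= xj andbT leqNgt.
by apply/negP => /jmin; rewrite ltnn.
Qed.
End Cuts.

Section Segments.
Variables (R : realType) (m : nat) (v : {set 'I_m} -> R).
Hypotheses (v_norm : normalized v) (v_mono : monotonic v).

Definition segment_utility (a b : nat) : R := v (segment m a b).

Lemma segment_utility_nil a b : b <= a -> segment_utility a b = 0%R.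
Proof.
move=> ba; rewrite /segment_utility -v_norm; congr v; apply/setP => x.
by rewrite !inE; lia.
Qed.

Lemma segment_utility_mono a a' b b' :
  a' <= a -> b <= b' -> (segment_utility a b <= segment_utility a' b')%R.
Proof. by move=> aa' bb'; apply: v_mono; apply/subsetP => x; rewrite !inE; lia. Qed.

Lemma segment_up_to_one a b (x : R) :
  (segment_utility a.+1 b <= x)%R \/ (segment_utility a b.-1 <= x)%R ->
  exists B : {set 'I_m}, [/\ B \subset segment m a b, #|B| <= 1 & (v (segment m a b :\: B) <= x)%R].
Proof.
(* [B] is good [p] if it lies in the segment, and empty otherwise. *)
have drop p a' b' : (segment_utility a' b' <= x)%R ->
    segment m a' b' = segment m a b :\: [set y in segment m a b | y == p :> nat] ->
    exists B : {set 'I_m}, [/\ B \subset segment m a b, #|B| <= 1 & (v (segment m a b :\: B) <= x)%R].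
  move=> le E; exists [set y in segment m a b | y == p :> nat]; split; last by rewrite -E.
    by apply/subsetP => y; rewrite inE => /andP[].
  apply/card_le1_eqP => y z; rewrite !inE => /andP[_ /eqP yp] /andP[_ /eqP zp].
  by apply: val_inj; rewrite /= yp zp.
by case=> le; [apply: (drop a _ _ le)|apply: (drop b.-1 _ _ le)];
  apply/setP => y; rewrite !inE; lia.
Qed.
End Segments.

Theorem theorem2 (R : realType) (k n m : nat) (sz : 'I_k -> nat)
    (u : 'I_n -> {set 'I_m} -> R)
    (hk : (2 <= k)%N)
    (hsz : forall i : 'I_k, (0 < sz i)%N)
    (hn : n = (\sum_(i < k) sz i)%N)
    (hu0 : forall a : 'I_n, normalized (u a))
    (humon : forall a : 'I_n, monotonic (u a)) :
  exists (C : 'I_k -> {set 'I_n}) (A : 'I_k -> {set 'I_m}),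
    [/\ outcome sz C A, connected A & EF1 u C A].
Proof.
case: k sz hk hsz hn => // d sz _ hsz hn.
(* [m.+1] instead of [m]: a worthless extra good keeps the path non-empty. *)
pose D := d.+4; pose L := (d.+1 * (n * d.+2)).+1; pose G := (m.+1 * D * L).-1.
have D0 : 0 < D by []. have L0 : 0 < L by [].
(* The path has [m.+1] goods of [D] coarse steps, each of [L] fine steps. *)
have GE : G.+1 = m.+1 * D * L by rewrite /G prednK // !muln_gt0.
pose U a := segment_utility (u a).
have U_nil a := segment_utility_nil (hu0 a).
have U_mono a := segment_utility_mono (humon a).
pose fav a := favourite (U a) d D.
have favP a s (y : {ffun 'I_d -> nat}) : s < L -> let c := coarse G.+1 L s y in
    nth 0 c (fav a c) < nth 0 c (fav a c).+1 /\
    forall l : 'I_d.+1, (nth_value (U a) D c l <= nth_value (U a) D c (fav a c))%R.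
  move=> sL; apply: (favouriteP (U_nil a) (U_mono a)) => [j jd|].
    rewrite !nth_coarse ?(leqW jd) //; apply: leq_div2r.
    by rewrite leq_add2r knife_mono.
  rewrite !nth_coarse // add0n divn_small // knife_last GE divnMDl // addn_gt0.
have favP1 a s y (sL : s < L) := proj1 (favP a s y sL).
have [y [g [gs gsz]]] := @balanced_assignment n d G L sz fav hsz hn (ltnSn _) favP1.
pose base j := knife G.+1 y j %/ L.
(* There are [D - 1 = d.+3] thresholds and only [d.+2] residues to avoid. A knife one coarse step
   beyond its base then rounds alike, so all agents see the same cuts. *)
have [|T TD Tbase] := @avoid_residues D [seq base j %% D | j <- iota 0 d.+2].
  by rewrite size_map size_iota.
pose cut j := round_knife D T (base j).
have cutE s j : s < L -> j <= d.+1 -> round_knife D T (nth 0 (coarse G.+1 L s y) j) = cut j.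
  move=> sL jd; rewrite nth_coarse //.
  have [->//|->] := divnD_small (knife G.+1 y j) sL.
  apply: round_knife_succ => //; apply: contraNneq Tbase => <-.
  by apply/mapP; exists j; rewrite // mem_iota.
have cut0 : cut 0 = 0.
  by rewrite /cut /base /= div0n /round_knife div0n mod0n leqNgt (andP TD).1.
have cut_last : m <= cut d.+1.
  rewrite /cut /base knife_last GE mulnK // /round_knife mulnK //.
  by apply: leq_trans (leq_addr _ _).
have cut_mono i j : i <= j <= d.+1 -> cut i <= cut j.
  by move=> ij; apply/leq_round_knife/leq_div2r => //; apply: knife_le.
pose A (j : 'I_d.+1) := segment m (cut j) (cut j.+1).
exists (fun j => [set a | g a == j]), A; split.
- split; last exact: (segments_cover cut0 cut_last).
    split=> // [i j ij|].
      rewrite disjoint_subset; apply/subsetP => a; rewrite !inE => /eqP ->.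
      exact: ij.
    by apply/setP => a; rewrite inE; apply/bigcupP; exists (g a); rewrite ?inE.
  exact: (segments_disjoint m cut_mono).
- by move=> j; exists (cut j), (cut j.+1).
move=> i j a; rewrite inE => /eqP gi.
apply: segment_up_to_one.
(* At the agent's own position [s]: [A j] up to one good is worth at most the value of piece [j],
   hence at most that of piece [i], hence at most [A i]. *)
have [s favs] := gs a; have [_ best] := favP a s y (ltn_ord s).
have bounds (l : 'I_d.+1) := piece_value_round (U_mono a)
  (nth 0 (coarse G.+1 L s y) l) (nth 0 (coarse G.+1 L s y) l.+1) TD.
have [upper _] := bounds i; have [_ lower] := bounds j.
move: (best j) upper lower; rewrite favs gi /nth_value !cutE ?(ltnW (ltn_ord _)) ?ltn_ord //.
move=> ji upper; have le := le_trans ji upper.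
by case=> lower; [left|right]; apply: le_trans lower le.
Qed.
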